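(* With the interpretation $\mathcal I$ of a signature over $\mathrm{Pow}_\sigma(\mathrm{Points})$ described below, for every predicate $\phi$ we have $[\![\phi]\!]=\{p\in\mathrm{Points}\mid\phi\in p\}$.
   Context: Atoms $\mathbb A$ (countably infinite; $a,b,c$ distinct), permutations, swappings $(a\ b)$, nominal support $\mathrm{supp}$, freshness $a\#x$, and $\mathsf N a$ = ''for all but finitely many atoms $a$''. Syntax: terms $r::=a\mid\mathsf f(r_1..r_n)$; predicates $\phi::=\bot\mid r=r\mid\mathsf P(\vec r)\mid\phi\wedge\phi\mid\neg\phi\mid\forall a.\phi$ up to $\alpha$-equivalence, with capture-avoiding substitution $\phi[a:=r]$; permutations act by renaming atoms; $\top=\neg\bot$, $\phi\vee\psi=\neg(\neg\phi\wedge\neg\psi)$. $\phi\vdash\psi$ denotes derivability in the standard classical sequent calculus of first-order logic with equality. A filter is a nonempty set $p$ of predicates (not necessarily finitely supported) with: $\bot\notin p$; $\phi\in p$ and $\phi\vdash\phi'$ imply $\phi'\in p$; $\phi,\phi'\in p$ imply $\phi\wedge\phi'\in p$; if $\mathsf N b.\,(b\ a)\cdot\phi\in p$ then $\forall a.\phi\in p$. It is prime if $\phi_1\vee\phi_2\in p$ implies $\phi_1\in p$ or $\phi_2\in p$. $\mathrm{Points}$ is the set of prime filters, with $\pi\cdot p=\{\pi\cdot\phi\mid\phi\in p\}$ and $p[r\Leftarrow a]=\{\phi\mid\phi[a:=r]\in p\}$ for terms $r$. For $X\subseteq\mathrm{Points}$: $\pi\cdot X$ pointwise and $X[a:=r]=\{p\mid\mathsf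 N c.\ p[r\Leftarrow c]\in(c\ a)\cdot X\}$. $\mathrm{Pow}_\sigma(\mathrm{Points})$ is the set of finitely supported $X\subseteq\mathrm{Points}$ with (1) $\forall r\,\mathsf N a\,\forall p\,(p[r\Leftarrow a]\in X\iff p\in X)$ and (2) $\forall a\,\mathsf N b\,\forall p\,(p[b\Leftarrow a]\in X\iff(b\ a)\cdot p\in X)$. Interpretation $\mathcal I$: terms interpreted as themselves ($[\![r]\!]=r$, with real substitution); $\mathsf P^{\mathcal I}(a_1,..,a_n)=\{p\mid\mathsf P(a_1,..,a_n)\in p\}$ and $\mathsf P^{\mathcal I}(r_1,..,r_n)=\mathsf P^{\mathcal I}(a_1,..,a_n)[a_1:=r_1]\cdots[a_n:=r_n]$ for distinct atoms $a_i$ fresh for the $r_j$; and $[\![\bot]\!]=\emptyset$, $[\![r=s]\!]=\{p\mid\mathsf N c.\ p[r\Leftarrow c]=p[s\Leftarrow c]\}$, $[\![\mathsf P(\vec r)]\!]=\mathsf P^{\mathcal I}(\vec r)$, $[\![\phi\wedge\psi]\!]=[\![\phi]\!]\cap[\![\psi]\!]$, $[\![\neg\phi]\!]=\mathrm{Points}\setminus[\![\phi]\!]$, $[\![\forall a.\phi]\!]=\bigcap_{r}[\![\phi]\!][a:=r]$ ($r$ ranging over all terms). *)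

(* Defs.v *)
From HB Require Import structures.
From mathcomp Require Import all_boot all_classical.

Set Implicit Arguments.
Unset Strict Implicit.
Unset Printing Implicit Defensive.

Local Open Scope classical_set_scope.
Local Open Scope quotient_scope.

Definition atom : Type := nat.

Definition fresh_atom (L : seq nat) : atom := (\max_(x <- L) x).+1.

Definition swap (a b : atom) (c : atom) : atom :=
  if c == a then b else if c == b then a else c.

Definition finperm (f : atom -> atom) : Prop :=
  bijective f /\ finite_set [set a | f a <> a].

(* The nominal "new" quantifier: for all but finitely many atoms. *)
Definition new (Q : atom -> Prop) : Prop := finite_set (~` [set a | Q a]).

Definition upd (T : Type) (s : atom -> T) (a : atom) (t : T) : atom -> T :=
  fun c => if c == a then t else s c.

Record signature : Type := Signature {
  funsym : Type;
  farity : funsym -> nat;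
  predsym : Type;
  parity : predsym -> nat }.

Section Syntax.
Variable S : signature.

Inductive term : Type :=
| Var of atom
| Fn (f : funsym S) of ('I_(farity f) -> term).

Fixpoint tatoms (r : term) : seq atom :=
  match r with
  | Var a => [:: a]
  | Fn f rs => flatten [seq tatoms (rs i) | i <- enum 'I_(farity f)]
  end.

Fixpoint tren (h : atom -> atom) (r : term) : term :=
  match r with
  | Var a => Var (h a)
  | Fn f rs => Fn (fun i => tren h (rs i))
  end.

Fixpoint tsub (s : atom -> term) (r : term) : term :=
  match r with
  | Var a => s a
  | Fn f rs => Fn (fun i => tsub s (rs i))
  end.

(* Raw syntax; predicates are its quotient by alpha-equivalence, see [form]. *)
Inductive raw : Type :=
| Bot
| Eq of term & term
| Pr (P : predsym S) of ('I_(parity P) -> term)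
| And of raw & raw
| Neg of raw
| All of atom & raw.

(* All atoms that occur, including binding occurrences. *)
Fixpoint ratoms (phi : raw) : seq atom :=
  match phi with
  | Bot => [::]
  | Eq r s => tatoms r ++ tatoms s
  | Pr P rs => flatten [seq tatoms (rs i) | i <- enum 'I_(parity P)]
  | And phi psi => ratoms phi ++ ratoms psi
  | Neg phi => ratoms phi
  | All a phi => a :: ratoms phi
  end.

Fixpoint rfv (phi : raw) : seq atom :=
  match phi with
  | Bot => [::]
  | Eq r s => tatoms r ++ tatoms s
  | Pr P rs => flatten [seq tatoms (rs i) | i <- enum 'I_(parity P)]
  | And phi psi => rfv phi ++ rfv psi
  | Neg phi => rfv phi
  | All a phi => [seq c <- rfv phi | c != a]
  end.

Fixpoint rren (h : atom -> atom) (phi : raw) : raw :=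
  match phi with
  | Bot => Bot
  | Eq r s => Eq (tren h r) (tren h s)
  | Pr P rs => Pr (fun i => tren h (rs i))
  | And phi psi => And (rren h phi) (rren h psi)
  | Neg phi => Neg (rren h phi)
  | All a phi => All (h a) (rren h phi)
  end.

(* Capture-avoiding simultaneous substitution. Every binder is renamed to an
   atom that is fresh for the terms substituted in its scope, which makes the
   recursion structural. *)
Fixpoint rsub (s : atom -> term) (phi : raw) : raw :=
  match phi with
  | Bot => Bot
  | Eq r t => Eq (tsub s r) (tsub s t)
  | Pr P rs => Pr (fun i => tsub s (rs i))
  | And phi psi => And (rsub s phi) (rsub s psi)
  | Neg phi => Neg (rsub s phi)
  | All a phi =>
      let b := fresh_atom
        (flatten [seq tatoms (s c) | c <- rfv phi & c != a]) in
      All b (rsub (upd s a (Var b)) phi)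
  end.

Inductive alpha : raw -> raw -> Prop :=
| alpha_Bot : alpha Bot Bot
| alpha_Eq r s : alpha (Eq r s) (Eq r s)
| alpha_Pr P rs : alpha (@Pr P rs) (@Pr P rs)
| alpha_And phi psi phi' psi' :
    alpha phi phi' -> alpha psi psi' -> alpha (And phi psi) (And phi' psi')
| alpha_Neg phi phi' : alpha phi phi' -> alpha (Neg phi) (Neg phi')
| alpha_All a b c phi psi :
    c \notin ratoms (All a phi) -> c \notin ratoms (All b psi) ->
    alpha (rren (swap c a) phi) (rren (swap c b) psi) ->
    alpha (All a phi) (All b psi).

Lemma fresh_atomP (L : seq nat) : fresh_atom L \notin L.
Proof.
apply/negP => LL; have := @leq_bigmax_seq _ L xpredT id _ LL isT.
by rewrite ltnn.
Qed.

Lemma swapK a b : involutive (swap a b).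
Proof.
move=> c; rewrite /swap; case: (eqVneq c a) => [->|ca].
  by rewrite eqxx; case: eqVneq.
case: (eqVneq c b) => [->|cb]; first by rewrite eqxx.
by rewrite (negPf ca) (negPf cb).
Qed.

Lemma inj_swap h a b c : injective h -> h (swap a b c) = swap (h a) (h b) (h c).
Proof. by move=> hI; rewrite /swap !(inj_eq hI); case: ifP => //; case: ifP. Qed.

Lemma tren_ext h k r : {in tatoms r, h =1 k} -> tren h r = tren k r.
Proof.
elim: r => [a|f rs IH] /= hk; first by rewrite hk ?inE.
congr Fn; apply: funext => i; apply: IH => x xi; apply: hk.
by apply/flatten_mapP; exists i; rewrite ?mem_enum.
Qed.

Lemma rren_ext h k phi : {in ratoms phi, h =1 k} -> rren h phi = rren k phi.
Proof.
elim: phi => [|r s|P rs|phi IH psi IH'|phi IH|a phi IH] //= hk.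
- by congr Eq; apply: tren_ext => x xr; apply: hk; rewrite mem_cat xr ?orbT.
- congr Pr; apply: funext => i; apply: tren_ext => x xi; apply: hk.
  by apply/flatten_mapP; exists i; rewrite ?mem_enum.
- by congr And; [apply: IH|apply: IH'] => x xr; apply: hk;
    rewrite mem_cat xr ?orbT.
- by rewrite IH.
- by rewrite hk ?mem_head // IH // => x xp; apply: hk; rewrite inE xp orbT.
Qed.

Lemma tren_comp h k r : tren h (tren k r) = tren (h \o k) r.
Proof.
by elim: r => //= f rs IH; congr Fn; apply: funext => i; apply: IH.
Qed.

Lemma rren_comp h k phi : rren h (rren k phi) = rren (h \o k) phi.
Proof.
elim: phi => //= [r s|P rs|phi -> psi ->|phi ->|a phi ->] //.
- by rewrite !tren_comp.
- by congr Pr; apply: funext => i; rewrite tren_comp.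
Qed.

Lemma tatoms_ren h r : tatoms (tren h r) = map h (tatoms r).
Proof.
elim: r => //= f rs IH; rewrite map_flatten -map_comp.
by congr flatten; apply: eq_map => i; apply: IH.
Qed.

Lemma ratoms_ren h phi : ratoms (rren h phi) = map h (ratoms phi).
Proof.
elim: phi => //= [r s|P rs|phi -> psi ->|a phi ->] //.
- by rewrite map_cat !tatoms_ren.
- rewrite map_flatten -map_comp; congr flatten.
  by apply: eq_map => i; apply: tatoms_ren.
- by rewrite map_cat.
Qed.

Lemma rren_swap_swap c d a phi :
  c \notin a :: ratoms phi -> d \notin a :: ratoms phi ->
  rren (swap c d) (rren (swap d a) phi) = rren (swap c a) phi.
Proof.
rewrite !inE !negb_or => /andP[ca cp] /andP[da dp]; rewrite rren_comp.
apply: rren_ext => x xp /=.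
have xc : x != c by apply: contraNneq cp => <-.
have xd : x != d by apply: contraNneq dp => <-.
rewrite /swap (negPf xd) (negPf xc); case: (eqVneq x a) => [xa|_].
  by rewrite eqxx; case: eqVneq.
by rewrite (negPf xc) (negPf xd).
Qed.

Lemma alpha_ren h phi psi :
  injective h -> alpha phi psi -> alpha (rren h phi) (rren h psi).
Proof.
move=> hI; elim=> /= [|r s|P rs|? ? ? ? _ ? _ ?|? ? _ ?|]; try by constructor.
move=> a b c phi' psi' ca cb _ IH.
have E x chi : rren (swap (h c) (h x)) (rren h chi) =
               rren h (rren (swap c x) chi).
  by rewrite !rren_comp; apply: rren_ext => y _ /=; rewrite inj_swap.
apply: (@alpha_All _ _ (h c)); last by rewrite !E.
- by rewrite /= ratoms_ren -map_cons mem_map.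
- by rewrite /= ratoms_ren -map_cons mem_map.
Qed.

Lemma alpha_refl phi : alpha phi phi.
Proof.
suff H h : alpha (rren h phi) (rren h phi).
  have := H id; suff -> : rren id phi = phi by [].
  have tid r : tren id r = r.
    by elim: r => //= f rs IH; congr Fn; apply: funext.
  elim: phi {H} => //= [r s|P rs|phi -> psi ->|phi ->|a phi ->] //.
  - by rewrite !tid.
  - by congr Pr; apply: funext.
elim: phi h => /= [|r s|P rs|phi IH psi IH'|phi IH|a phi IH] h;
  try by constructor.
have cP := fresh_atomP (h a :: ratoms (rren h phi)).
by apply: (alpha_All cP cP); rewrite !rren_comp.
Qed.

Lemma alpha_sym phi psi : alpha phi psi -> alpha psi phi.
Proof.
elim=> [|r s|P rs|? ? ? ? _ ? _ ?|? ? _ ?|]; try by constructor.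
by move=> a b c phi' psi' ca cb _; apply: alpha_All.
Qed.

Lemma alpha_trans phi psi chi : alpha phi psi -> alpha psi chi -> alpha phi chi.
Proof.
move=> H; elim: H chi => {phi psi} //=.
- move=> phi psi phi' psi' _ IH _ IH' chi H.
  by inversion H; subst; constructor; [apply: IH|apply: IH'].
- by move=> phi phi' _ IH chi H; inversion H; subst; constructor; apply: IH.
- move=> a b c phi psi ca cb _ IH chi H; inversion H as [| | | | |b' d e psi' x eb ed H']; subst.
  set L := a :: b :: c :: d :: e :: ratoms phi ++ ratoms psi ++ ratoms x.
  have := fresh_atomP L; move: (fresh_atom L) => g.
  rewrite !inE !mem_cat !negb_or.
  case/and5P=> ga gb gc gd /and4P[ge gp gs gx].
  have gP : g \notin ratoms (All a phi) by rewrite inE negb_or ga.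
  have gS : g \notin ratoms (All b psi) by rewrite inE negb_or gb.
  have gX : g \notin ratoms (All d x) by rewrite inE negb_or gd.
  have swI u v : injective (swap u v) := inv_inj (swapK u v).
  apply: (alpha_All gP gX).
  have {H' H} := alpha_ren (swI g e) H'; rewrite !rren_swap_swap //.
  move=> /(alpha_ren (swI c g)); rewrite rren_swap_swap // => /IH.
  move=> /(alpha_ren (swI c g)); rewrite [X in alpha _ X]rren_comp.
  have -> : swap c g \o swap c g = id by apply: funext => y /=; rewrite swapK.
  have -> : swap c g = swap g c.
    apply: funext => y; rewrite /swap; case: (eqVneq y c) => [->|//].
    by rewrite eq_sym (negPf gc).
  rewrite rren_swap_swap //; rewrite rren_comp.
  by have -> : id \o swap g d = swap g d by [].
Qed.

Lemma rfv_ren h phi : injective h -> rfv (rren h phi) = map h (rfv phi).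
Proof.
move=> hI; elim: phi => //= [r s|P rs|phi -> psi ->|a phi ->] //.
- by rewrite map_cat !tatoms_ren.
- rewrite map_flatten -map_comp; congr flatten.
  by apply: eq_map => i; apply: tatoms_ren.
- by rewrite map_cat.
- by rewrite filter_map; congr map; apply: eq_filter => x /=; rewrite inj_eq.
Qed.

Lemma rfv_ratoms phi : {subset rfv phi <= ratoms phi}.
Proof.
elim: phi => [|r s|P rs|phi IH psi IH'|phi IH|a phi IH] x //=; last first.
- by rewrite mem_filter inE => /andP[_ /IH->]; rewrite orbT.
- exact: IH.
- by rewrite !mem_cat => /orP[/IH->|/IH'->]; rewrite ?orbT.
Qed.

Lemma alpha_rfv phi psi : alpha phi psi -> rfv phi =i rfv psi.
Proof.
elim=> {phi psi} [|r s|P rs|phi psi phi' psi' _ IH _ IH' x|phi phi' _ IH x|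
  a b c phi psi] //=; first by rewrite !mem_cat IH IH'.
have swI u v : injective (swap u v) := inv_inj (swapK u v).
move=> ca cb _; rewrite !rfv_ren //.
have swE u chi x : c \notin u :: ratoms chi -> x \in map (swap c u) (rfv chi) =
   ((x == c) && (u \in rfv chi)) || ((x != c) && (x \in rfv chi) && (x != u)).
  rewrite inE negb_or => /andP[cu cchi].
  rewrite -{1}[x](swapK c u) mem_map // /swap.
  have /negPf cf : c \notin rfv chi by apply: contra cchi => /rfv_ratoms.
  case: (eqVneq x c) => [->|xc] /=; first by rewrite orbF.
  by case: (eqVneq x u) => [->|xu]; rewrite ?cf ?andbF ?andbT.
move=> IH x; rewrite !mem_filter.
have [->|xc] := eqVneq x c.
  have fc u chi : c \notin u :: ratoms chi -> c \in rfv chi = false.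
    rewrite inE negb_or => /andP[_ H].
    by apply/negbTE; apply: contra H => /rfv_ratoms.
  by rewrite (fc _ _ ca) (fc _ _ cb) !andbF.
by have := IH x; rewrite !swE // (negPf xc) /= [_ && (x != a)]andbC [_ && (x != b)]andbC.
Qed.

Lemma tsub_ext s t r : {in tatoms r, s =1 t} -> tsub s r = tsub t r.
Proof.
elim: r => [a|f rs IH] /= st; first by rewrite st ?inE.
congr Fn; apply: funext => i; apply: IH => x xi; apply: st.
by apply/flatten_mapP; exists i; rewrite ?mem_enum.
Qed.

Lemma rsub_ext s t phi : {in rfv phi, s =1 t} -> rsub s phi = rsub t phi.
Proof.
elim: phi s t => [|r u|P rs|phi IH psi IH'|phi IH|a phi IH] s t //= st.
- by congr Eq; apply: tsub_ext => x xr; apply: st; rewrite mem_cat xr ?orbT.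
- congr Pr; apply: funext => i; apply: tsub_ext => x xi; apply: st.
  by apply/flatten_mapP; exists i; rewrite ?mem_enum.
- by congr And; [apply: IH|apply: IH'] => x xr; apply: st;
    rewrite mem_cat xr ?orbT.
- by congr Neg; apply: IH.
- have -> : [seq tatoms (s c) | c <- rfv phi & c != a] =
            [seq tatoms (t c) | c <- rfv phi & c != a].
    by apply/eq_in_map => c /st ->.
  congr All; apply: IH => x xp; rewrite /upd; case: ifPn => // xa.
  by apply: st; rewrite mem_filter xa.
Qed.

Lemma tsub_ren s h r : tsub s (tren h r) = tsub (s \o h) r.
Proof.
by elim: r => //= f rs IH; congr Fn; apply: funext => i; apply: IH.
Qed.

Lemma rsub_ren s h phi :
  injective h -> rsub s (rren h phi) = rsub (s \o h) phi.
Proof.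
move=> hI; elim: phi s => [|r u|P rs|phi IH psi IH'|phi IH|a phi IH] s //=.
- by rewrite !tsub_ren.
- by congr Pr; apply: funext => i; rewrite tsub_ren.
- by rewrite IH IH'.
- by rewrite IH.
- rewrite IH rfv_ren // filter_map -map_comp.
  rewrite (@eq_filter _ (preim h (fun c => c != h a)) (fun c => c != a));
    last by move=> x /=; rewrite inj_eq.
  congr All; apply: rsub_ext => x _ /=; by rewrite /upd inj_eq.
Qed.

Lemma eq_fresh_atom (L M : seq nat) : L =i M -> fresh_atom L = fresh_atom M.
Proof.
move=> LM; rewrite /fresh_atom; congr _.+1; apply/eqP; rewrite eqn_leq.
by apply/andP; split; apply/bigmax_leqP_seq => x xL _;
  apply: (@leq_bigmax_seq _ _ xpredT id); rewrite // ?LM // -LM.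
Qed.

Lemma alpha_rsub phi psi s : alpha phi psi -> rsub s phi = rsub s psi.
Proof.
move=> H; elim: H s => {phi psi} //= [? ? ? ? _ IH _ IH'|? ? _ IH|] //.
- by move=> s; rewrite IH IH'.
- by move=> s; rewrite IH.
move=> a b c phi psi ca cb H IH s.
have swI u v : injective (swap u v) := inv_inj (swapK u v).
have fvE : rfv (All a phi) =i rfv (All b psi).
  by apply: alpha_rfv; apply: (alpha_All ca cb).
have E u chi t : c \notin u :: ratoms chi ->
    rsub (upd s u t) chi = rsub (upd s c t) (rren (swap c u) chi).
  rewrite inE negb_or => /andP[cu cchi]; rewrite rsub_ren //.
  apply: rsub_ext => x /rfv_ratoms xp.
  have xc : x != c by apply: contraNneq cchi => <-.
  rewrite /= /upd /swap (negPf xc); case: (eqVneq x u) => [_|_].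
    by rewrite eqxx.
  by rewrite (negPf xc).
rewrite (E a) // (E b) // IH.
have -> // : fresh_atom (flatten [seq tatoms (s c0) | c0 <- rfv phi & c0 != a]) =
        fresh_atom (flatten [seq tatoms (s c0) | c0 <- rfv psi & c0 != b]).
apply: eq_fresh_atom => x.
apply/flatten_mapP/flatten_mapP => -[y yf xy]; exists y => //.
  by have := fvE y; rewrite /= yf => <-.
by have := fvE y; rewrite /= yf => ->.
Qed.

Lemma alpha_All_congr a phi psi :
  alpha phi psi -> alpha (All a phi) (All a psi).
Proof.
move=> H; set L := a :: ratoms phi ++ ratoms psi.
have := fresh_atomP L; move: (fresh_atom L) => c.
rewrite inE mem_cat !negb_or => /and3P[ca cp cs].
apply: (@alpha_All _ _ c); rewrite ?inE ?negb_or ?ca //.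
by apply: alpha_ren => //; apply: inv_inj; apply: swapK.
Qed.

HB.instance Definition _ := gen_eqMixin raw.
HB.instance Definition _ := gen_choiceMixin raw.

Definition alphab : rel raw := fun phi psi => `[< alpha phi psi >].

Lemma alphab_refl : reflexive alphab.
Proof. by move=> phi; apply/asboolP/alpha_refl. Qed.

Lemma alphab_sym : symmetric alphab.
Proof. by move=> phi psi; apply/asboolP/asboolP => /alpha_sym. Qed.

Lemma alphab_trans : transitive alphab.
Proof.
by move=> psi phi chi /asboolP H /asboolP H'; apply/asboolP/(alpha_trans H H').
Qed.

Canonical alpha_equiv : equiv_rel raw :=
  EquivRel alphab alphab_refl alphab_sym alphab_trans.

(* Predicates up to alpha-equivalence. The operations below are computed on
   representatives; lemmas [fandE] to [ffreshE] show independence of them. *)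
Definition form : Type := {eq_quot alpha_equiv}.

Definition cls (phi : raw) : form := \pi_form phi.

Definition fbot : form := cls Bot.
Definition feq (r s : term) : form := cls (Eq r s).
Definition fpr (P : predsym S) (rs : 'I_(parity P) -> term) : form :=
  cls (Pr rs).
Definition fand (x y : form) : form := cls (And (repr x) (repr y)).
Definition fneg (x : form) : form := cls (Neg (repr x)).
Definition for_ (x y : form) : form := fneg (fand (fneg x) (fneg y)).
Definition fall (a : atom) (x : form) : form := cls (All a (repr x)).
Definition fact (h : atom -> atom) (x : form) : form := cls (rren h (repr x)).
Definition fsub (x : form) (a : atom) (r : term) : form :=
  cls (rsub (upd Var a r) (repr x)).

(* The support of an alpha-equivalence class is its set of free atoms. *)
Definition ffresh (a : atom) (x : form) : Prop := a \notin rfv (repr x).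

Lemma clsP phi psi : cls phi = cls psi <-> alpha phi psi.
Proof.
split=> [/eqP|H]; first by rewrite /cls eqmodE => /asboolP.
by apply/eqP; rewrite /cls eqmodE; apply/asboolP.
Qed.

Lemma alpha_repr phi : alpha (repr (cls phi)) phi.
Proof. by apply/clsP; rewrite /cls reprK. Qed.

Lemma fandE phi psi : fand (cls phi) (cls psi) = cls (And phi psi).
Proof. by apply/clsP; constructor; apply: alpha_repr. Qed.

Lemma fnegE phi : fneg (cls phi) = cls (Neg phi).
Proof. by apply/clsP; constructor; apply: alpha_repr. Qed.

Lemma fallE a phi : fall a (cls phi) = cls (All a phi).
Proof. by apply/clsP/alpha_All_congr/alpha_repr. Qed.

Lemma factE h phi : injective h -> fact h (cls phi) = cls (rren h phi).
Proof. by move=> hI; apply/clsP/alpha_ren => //; apply: alpha_repr. Qed.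

Lemma fsubE phi a r : fsub (cls phi) a r = cls (rsub (upd Var a r) phi).
Proof. by rewrite /fsub (alpha_rsub _ (alpha_repr phi)). Qed.

Lemma ffreshE a phi : ffresh a (cls phi) <-> a \notin rfv phi.
Proof. by rewrite /ffresh (alpha_rfv (alpha_repr phi)). Qed.

(* [lk Phi Psi]: classical sequent calculus LK with equality, on lists taken up
   to the structural rules. *)
Inductive lk : seq form -> seq form -> Prop :=
| lk_struct Phi Psi Phi' Psi' :
    {subset Phi <= Phi'} -> {subset Psi <= Psi'} -> lk Phi Psi -> lk Phi' Psi'
| lk_hyp x : lk [:: x] [:: x]
| lk_cut x Phi Psi : lk Phi (x :: Psi) -> lk (x :: Phi) Psi -> lk Phi Psi
| lk_botL : lk [:: fbot] [::]
| lk_andL x y Phi Psi : lk (x :: y :: Phi) Psi -> lk (fand x y :: Phi) Psi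
| lk_andR x y Phi Psi :
    lk Phi (x :: Psi) -> lk Phi (y :: Psi) -> lk Phi (fand x y :: Psi)
| lk_negL x Phi Psi : lk Phi (x :: Psi) -> lk (fneg x :: Phi) Psi
| lk_negR x Phi Psi : lk (x :: Phi) Psi -> lk Phi (fneg x :: Psi)
| lk_allL a r x Phi Psi : lk (fsub x a r :: Phi) Psi -> lk (fall a x :: Phi) Psi
| lk_allR a x Phi Psi :
    {in Phi, forall y, ffresh a y} -> {in Psi, forall y, ffresh a y} ->
    lk Phi (x :: Psi) -> lk Phi (fall a x :: Psi)
| lk_eqL a r s x Phi Psi :
    lk (fsub x a s :: Phi) Psi -> lk (feq r s :: fsub x a r :: Phi) Psi
| lk_eqR r : lk [::] [:: feq r r].

Definition entails (x y : form) : Prop := lk [:: x] [:: y].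

Record is_filter (p : set form) : Prop := IsFilter {
  filter_nonempty : p !=set0;
  filter_bot : ~ p fbot;
  filter_up : forall x y, p x -> entails x y -> p y;
  filter_and : forall x y, p x -> p y -> p (fand x y);
  filter_all : forall a x, new (fun b => p (fact (swap b a) x)) -> p (fall a x) }.

Definition is_prime (p : set form) : Prop :=
  forall x y, p (for_ x y) -> p x \/ p y.

Definition Points : set (set form) := [set p | is_filter p /\ is_prime p].

Definition ptact (h : atom -> atom) (p : set form) : set form := fact h @` p.

(* [ptsub p r a] is p[r <= a]. *)
Definition ptsub (p : set form) (r : term) (a : atom) : set form :=
  [set x | p (fsub x a r)].

Definition setact (h : atom -> atom) (X : set (set form)) : set (set form) :=
  ptact h @` X.

(* [setsub X a r] is X[a := r]. *)
Definition setsub (X : set (set form)) (a : atom) (r : term) : set (set form) :=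
  [set p | Points p /\ new (fun c => setact (swap c a) X (ptsub p r c))].

Definition finsupported (X : set (set form)) : Prop :=
  exists2 A : set atom, finite_set A &
    forall h, finperm h -> (forall a, A a -> h a = a) -> setact h X = X.

Record pow_sigma (X : set (set form)) : Prop := PowSigma {
  pow_sigma_sub : X `<=` Points;
  pow_sigma_supp : finsupported X;
  pow_sigma_fresh : forall r, new (fun a =>
    forall p, Points p -> (X (ptsub p r a) <-> X p));
  pow_sigma_alpha : forall a, new (fun b =>
    forall p, Points p -> (X (ptsub p (Var b) a) <-> X (ptact (swap b a) p))) }.

(* A choice, for each P(r_1,...,r_n), of the distinct atoms a_i fresh for the
   r_j through which the interpretation of P(r_1,...,r_n) is defined. *)
Definition atom_choice : Type :=
  forall P : predsym S, ('I_(parity P) -> term) -> 'I_(parity P) -> atom.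

Definition admissible (nu : atom_choice) : Prop :=
  forall (P : predsym S) (rs : 'I_(parity P) -> term),
    injective (nu P rs) /\ forall i j, nu P rs i \notin tatoms (rs j).

Definition predI_atoms (P : predsym S) (a : 'I_(parity P) -> atom) :
    set (set form) :=
  [set p | Points p /\ p (fpr (fun i => Var (a i)))].

Definition predI (nu : atom_choice) (P : predsym S)
    (rs : 'I_(parity P) -> term) : set (set form) :=
  foldl (fun X i => setsub X (nu P rs i) (rs i))
    (predI_atoms (nu P rs)) (enum 'I_(parity P)).

(* Defined on raw syntax, hence for every choice of the bound atoms. *)
Fixpoint interp (nu : atom_choice) (phi : raw) : set (set form) :=
  match phi with
  | Bot => set0
  | Eq r s => [set p | Points p /\ new (fun c => ptsub p r c = ptsub p s c)]
  | Pr P rs => predI nu rs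
  | And phi psi => interp nu phi `&` interp nu psi
  | Neg phi => Points `\` interp nu phi
  | All a phi => \bigcap_(r in [set: term]) setsub (interp nu phi) a r
  end.

End Syntax.

(* Main.v *)
(** Write V(x) for the set of prime filters containing x. By induction on the
    predicate, its interpretation is V of its class; each clause of [interp]
    matches a closure property of prime filters. The bridge is
    V(x)[a := r] = V(x[a := r]), which needs that p[r <= a] is again a prime
    filter: closure under entailment holds because entailment is stable under
    substitution, and closure under the new-quantified introduction of forall
    because the bound atom can be renamed apart from a and r. For forall, a
    filter containing every instance x[a := r] contains in particular
    x[a := b] = (b a).x for all fresh b, hence forall a. x. For equality, the
    test predicate r = c with c fresh, substituted by r and by s, recovers
    r = s from p[r <= c] = p[s <= c]. *)

Require Import Defs.
From mathcomp Require Import all_boot all_classical.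

Set Implicit Arguments.
Unset Strict Implicit.
Unset Printing Implicit Defensive.

Local Open Scope classical_set_scope.
Local Open Scope quotient_scope.

(** * The new-quantifier and swappings *)

Lemma newP (Q : atom -> Prop) :
  new Q <-> exists L : seq nat, forall c : nat, c \notin L -> Q c.
Proof.
split=> [/finite_seqP[L LE]|[L LQ]].
  exists L => c cL; apply: contrapT => nQ; move/negP: cL; apply.
  by have : (~` [set a | Q a]) c by []; rewrite LE.
apply: (@sub_finite_set _ _ [set` L]); last exact: finite_seq.
by move=> c /= nQ; apply: contrapT => /negP /LQ.
Qed.

(** Discarding a finite list leaves cofinitely many atoms, so an implication under [new] need only
    be checked for atoms fresh for the predicates and terms at hand. *)
Lemma sub_new (L : seq nat) (P Q : atom -> Prop) :
  (forall c : nat, c \notin L -> P c -> Q c) -> new P -> new Q.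
Proof.
move=> LPQ /newP[M MP]; apply/newP; exists (L ++ M) => c.
by rewrite mem_cat negb_or => /andP[cL cM]; apply: LPQ => //; apply: MP.
Qed.

Lemma new_cst (Q : Prop) : new (fun=> Q) <-> Q.
Proof.
split=> [/newP[L LQ]|q]; last by apply/newP; exists [::].
exact: LQ (fresh_atomP L).
Qed.

Lemma swap_inj a b : injective (swap a b).
Proof. exact/inv_inj/swapK. Qed.

Lemma swapL a b : swap a b a = b.
Proof. by rewrite /swap eqxx. Qed.

Lemma swapR a b : swap a b b = a.
Proof. by rewrite -{2}(swapL a b) swapK. Qed.

Lemma swapN (a b c : nat) : c != a -> c != b -> swap a b c = c.
Proof. by rewrite /swap => /negPf -> /negPf ->. Qed.

(** * Renaming and substitution on raw predicates, up to alpha-equivalence *)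

Section Substitution.
Variable S : signature.
Implicit Types (phi psi : raw S) (x y : form S) (r s t : term S).

Lemma tren_id (h : atom -> atom) r : {in tatoms r, h =1 id} -> tren h r = r.
Proof.
elim: r => [a|f rs IH] /= hE; first by rewrite hE ?mem_head.
congr Fn; apply: funext => i; apply: IH => c ci; apply: hE.
by apply/flatten_mapP; exists i; rewrite ?mem_enum.
Qed.

Lemma tsub_id (s : atom -> term S) r : {in tatoms r, s =1 @Var S} -> tsub s r = r.
Proof.
elim: r => [a|f rs IH] /= sE; first by rewrite sE ?mem_head.
congr Fn; apply: funext => i; apply: IH => c ci; apply: sE.
by apply/flatten_mapP; exists i; rewrite ?mem_enum.
Qed.

Lemma tsub_upd_fresh a r t : a \notin tatoms t -> tsub (upd (@Var S) a r) t = t.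
Proof.
move=> aP; apply: tsub_id => c ct; rewrite /upd.
by case: eqVneq => // ca; rewrite -ca ct in aP.
Qed.

Lemma tren_tsub h (s : atom -> term S) r :
  tren h (tsub s r) = tsub (tren h \o s) r.
Proof. by elim: r => //= f rs IH; congr Fn; apply: funext => i; apply: IH. Qed.

Lemma tsub_VarE h r : tsub (@Var S \o h) r = tren h r.
Proof. by elim: r => //= f rs IH; congr Fn; apply: funext => i; apply: IH. Qed.

(** Values on bound atoms are invisible up to alpha: swapping both [h a] and [k a] with a common
    fresh [c] makes the two renamings agree on the bound atom [a] as well. *)
Lemma alpha_rren_ext h k phi : injective h -> injective k ->
  {in rfv phi, h =1 k} -> alpha (rren h phi) (rren k phi).
Proof.
elim: phi h k => [|r s|P rs|phi IH psi IH'|phi IH|a phi IH] h k hI kI /= hk.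
- by constructor.
- rewrite (@tren_ext _ h k r) ?(@tren_ext _ h k s); first exact: alpha_refl.
    by move=> c cs; apply: hk; rewrite mem_cat cs orbT.
  by move=> c cs; apply: hk; rewrite mem_cat cs.
- rewrite (_ : (fun i => _) = fun i => tren k (rs i)); first exact: alpha_refl.
  apply: funext => i; apply: tren_ext => c ci; apply: hk.
  by apply/flatten_mapP; exists i; rewrite ?mem_enum.
- by constructor; [apply: IH|apply: IH'] => // c cP; apply: hk;
    rewrite mem_cat cP ?orbT.
- by constructor; apply: IH.
set L := h a :: k a :: ratoms (rren h phi) ++ ratoms (rren k phi).
have := fresh_atomP L; move: (fresh_atom L) => c.
rewrite !inE mem_cat !negb_or => /and4P[cha cka ch ck].
apply: (@alpha_All _ _ _ c); rewrite ?inE ?negb_or ?cha ?cka //.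
rewrite !rren_comp; apply: IH => [||d dP].
- exact: inj_comp (@swap_inj _ _) hI.
- exact: inj_comp (@swap_inj _ _) kI.
rewrite /=; case: (eqVneq d a) => [->|da]; first by rewrite !swapR.
have dhk : h d = k d by apply: hk; rewrite mem_filter da.
have hdc : h d != c.
  by apply: contraNneq ch => <-; rewrite ratoms_ren map_f // rfv_ratoms.
by rewrite !swapN // -?dhk ?inj_eq // dhk inj_eq.
Qed.

Lemma alpha_All_swap a b phi : b \notin [seq c <- rfv phi | c != a] ->
  alpha (All b (rren (swap b a) phi)) (All a phi).
Proof.
move=> bP; set L := a :: b :: ratoms phi ++ ratoms (rren (swap b a) phi).
have := fresh_atomP L; move: (fresh_atom L) => c.
rewrite !inE mem_cat !negb_or => /and4P[ca cb cp cq].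
apply: (@alpha_All _ _ _ c); rewrite ?inE ?negb_or ?ca ?cb //.
rewrite rren_comp; apply: alpha_rren_ext => [||d dP].
- exact: inj_comp (@swap_inj _ _) (@swap_inj _ _).
- exact: swap_inj.
have dc : d != c by apply: contraNneq cp => <-; apply: rfv_ratoms.
rewrite /=; case: (eqVneq d a) => [->|da]; first by rewrite !swapR.
have db : d != b by apply: contraNneq bP => <-; rewrite mem_filter da.
by rewrite !swapN.
Qed.

Lemma alpha_rsub_Var h phi : injective h ->
  alpha (rsub (@Var S \o h) phi) (rren h phi).
Proof.
elim: phi h => [|r s|P rs|phi IH psi IH'|phi IH|a phi IH] h hI /=.
- by constructor.
- by rewrite !tsub_VarE; apply: alpha_refl.
- rewrite (_ : (fun i => _) = fun i => tren h (rs i)); first exact: alpha_refl.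
  by apply: funext => i; apply: tsub_VarE.
- by constructor; [apply: IH|apply: IH'].
- by constructor; apply: IH.
set L := flatten _; have := fresh_atomP L; move: (fresh_atom L) => b bL.
have bN c : c \in rfv phi -> c != a -> h c != b.
  move=> cP ca; apply: contraNneq bL => <-.
  by apply/flatten_mapP; exists c; rewrite ?mem_filter ?ca ?mem_head.
have kI : injective (swap b (h a) \o h) := inj_comp (@swap_inj _ _) hI.
(* On the free atoms of the body, the updated substitution is a renaming; writing it with a swapping
   keeps it injective, as the induction hypothesis requires. *)
rewrite (@rsub_ext _ _ (@Var S \o (swap b (h a) \o h))); last first.
  move=> c cP; rewrite /upd /=; case: eqVneq => [->|ca]; first by rewrite swapR.
  by rewrite swapN ?inj_eq // bN.
apply: alpha_trans (alpha_All_congr _ (IH _ kI)) _.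
rewrite -rren_comp; apply: alpha_All_swap; rewrite rfv_ren // mem_filter.
apply/negP => /andP[bha /mapP[c cP bc]]; have := bN c cP.
by rewrite bc eqxx => cb; rewrite bc inj_eq // in bha; move/(_ bha): cb.
Qed.

(* Equivariance of substitution for the body is a hypothesis so that this can
   serve in the inductive proof of that very fact, [alpha_rren_rsub]. *)
Lemma alpha_All_rsub_of a b c phi (s : atom -> term S) :
  (forall h (t : atom -> term S), injective h ->
     alpha (rren h (rsub t phi)) (rsub (tren h \o t) phi)) ->
  (forall d, d \in rfv phi -> d != a -> b \notin tatoms (s d)) ->
  (forall d, d \in rfv phi -> d != a -> c \notin tatoms (s d)) ->
  alpha (All b (rsub (upd s a (Var S b)) phi))
        (All c (rsub (upd s a (Var S c)) phi)).
Proof.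
move=> IH bP cP.
set B := rsub _ _; set C := rsub (upd s a (Var S c)) phi.
set M := flatten [seq tatoms (s d) | d <- rfv phi].
set L := b :: c :: ratoms B ++ ratoms C ++ M.
have := fresh_atomP L; move: (fresh_atom L) => e.
rewrite !inE !mem_cat !negb_or => /and5P[eb ec eB eC eM].
(* Applied to [b] and to [c], this brings both bodies to the same form, in which [a] is replaced by
   the fresh [e]. *)
have E d : (forall d', d' \in rfv phi -> d' != a -> d \notin tatoms (s d')) ->
    alpha (rren (swap e d) (rsub (upd s a (Var S d)) phi))
      (rsub (upd s a (Var S e)) phi).
  move=> dP; apply: alpha_trans (IH _ _ (@swap_inj _ _)) _.
  rewrite (@rsub_ext _ _ (upd s a (Var S e))); first exact: alpha_refl.
  move=> g gP; rewrite /= /upd; case: eqVneq => [_|ga] /=; first by rewrite swapR.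
  apply: tren_id => z zg; rewrite swapN //.
    by apply: contraNneq eM => <-; apply/flatten_mapP; exists g.
  by apply: contraNneq (dP g gP ga) => <-.
apply: (@alpha_All _ _ _ e); rewrite ?inE ?negb_or ?eb ?ec //.
exact: alpha_trans (E b bP) (alpha_sym (E c cP)).
Qed.

(** Equality can fail on raw syntax, since the two sides pick their binders independently: [h b] on
    the left, [c] on the right. Both avoid the renamed substituted terms, so [alpha_All_rsub_of]
    identifies them. *)
Lemma alpha_rren_rsub h (s : atom -> term S) phi : injective h ->
  alpha (rren h (rsub s phi)) (rsub (tren h \o s) phi).
Proof.
elim: phi h s => [|r s|P rs|phi IH psi IH'|phi IH|a phi IH] h t hI /=.
- by constructor.
- by rewrite !tren_tsub; apply: alpha_refl.
- rewrite (_ : (fun i => _) = fun i => tsub (tren h \o t) (rs i)).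
    exact: alpha_refl.
  by apply: funext => i; apply: tren_tsub.
- by constructor; [apply: IH|apply: IH'].
- by constructor; apply: IH.
set L := flatten _; have := fresh_atomP L; move: (fresh_atom L) => b bL.
set M := flatten _; have := fresh_atomP M; move: (fresh_atom M) => c cM.
apply: alpha_trans (alpha_All_congr _ (IH _ _ hI)) _.
rewrite (_ : tren h \o _ = upd (tren h \o t) a (Var S (h b))); last first.
  by apply: funext => d; rewrite /= /upd; case: ifP.
apply: alpha_All_rsub_of => [|d dP da|d dP da]; first by move=> *; apply: IH.
- rewrite /= tatoms_ren mem_map //; apply: contra bL => bd.
  by apply/flatten_mapP; exists d; rewrite ?mem_filter ?da.
- by apply: contra cM => cd; apply/flatten_mapP; exists d; rewrite ?mem_filter ?da.
Qed.

(** * Permutation and substitution laws on alpha-equivalence classes *)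

Lemma clsK x : cls (repr x) = x.
Proof. exact: reprK. Qed.

Lemma form_ind (Q : form S -> Prop) : (forall phi, Q (cls phi)) -> forall x, Q x.
Proof. by move=> H x; rewrite -(clsK x). Qed.

Lemma fact_ext h k x : injective h -> injective k ->
  (forall c, ~ ffresh c x -> h c = k c) -> fact h x = fact k x.
Proof.
move=> hI kI hk; apply/clsP/alpha_rren_ext => // c cx.
by apply: hk; rewrite /ffresh cx.
Qed.

Lemma fact_comp h k x : injective h -> injective k ->
  fact h (fact k x) = fact (h \o k) x.
Proof.
elim/form_ind: x => phi hI kI.
by rewrite !Defs.factE ?rren_comp //; apply: inj_comp.
Qed.

Lemma fact_id h x : injective h -> (forall c, ~ ffresh c x -> h c = c) ->
  fact h x = x.
Proof.
move=> hI hE; rewrite (@fact_ext _ id) //; elim/form_ind: x {hE} => phi.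
rewrite Defs.factE //; congr cls.
elim: phi => //= [r s|P rs|phi -> psi ->|phi ->|a phi ->] //.
- by rewrite !tren_id.
- by congr Pr; apply: funext => i; rewrite tren_id.
Qed.

Lemma fact_can h k x : injective h -> injective k -> cancel h k ->
  fact k (fact h x) = x.
Proof.
move=> hI kI hK; rewrite fact_comp //; apply: fact_id => [|c _]; last exact: hK.
exact: inj_comp.
Qed.

Lemma fact_bot h : injective h -> fact h (fbot S) = fbot S.
Proof. by move=> hI; rewrite /fbot Defs.factE. Qed.

Lemma fact_and h x y : injective h ->
  fact h (fand x y) = fand (fact h x) (fact h y).
Proof.
elim/form_ind: x => phi; elim/form_ind: y => psi hI.
by rewrite !(fandE, Defs.factE).
Qed.

Lemma fact_neg h x : injective h -> fact h (fneg x) = fneg (fact h x).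
Proof. by elim/form_ind: x => phi hI; rewrite !(fnegE, Defs.factE). Qed.

Lemma fact_all h a x : injective h ->
  fact h (fall a x) = fall (h a) (fact h x).
Proof. by elim/form_ind: x => phi hI; rewrite !(fallE, Defs.factE). Qed.

Lemma fact_eq h r s : injective h ->
  fact h (feq r s) = feq (tren h r) (tren h s).
Proof. by move=> hI; rewrite /feq Defs.factE. Qed.

Lemma fact_sub h x a r : injective h ->
  fact h (fsub x a r) = fsub (fact h x) (h a) (tren h r).
Proof.
elim/form_ind: x => phi hI; rewrite !(fsubE, Defs.factE) // rsub_ren //.
apply/clsP; apply: alpha_trans (alpha_rren_rsub _ _ hI) _.
rewrite (_ : _ \o h = tren h \o upd (@Var S) a r); first exact: alpha_refl.
by apply: funext => c; rewrite /= /upd inj_eq //; case: ifP.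
Qed.

Lemma ffresh_act h a x : injective h -> ffresh (h a) (fact h x) <-> ffresh a x.
Proof.
elim/form_ind: x => phi hI.
by rewrite Defs.factE // !ffreshE rfv_ren // mem_map.
Qed.

Lemma fsub_bot a r : fsub (fbot S) a r = fbot S.
Proof. by rewrite /fbot fsubE. Qed.

Lemma fsub_and x y a r : fsub (fand x y) a r = fand (fsub x a r) (fsub y a r).
Proof.
elim/form_ind: x => phi; elim/form_ind: y => psi.
by rewrite !(fandE, fsubE).
Qed.

Lemma fsub_neg x a r : fsub (fneg x) a r = fneg (fsub x a r).
Proof. by elim/form_ind: x => phi; rewrite !(fnegE, fsubE). Qed.

Lemma fsub_eq s t a r :
  fsub (feq s t) a r =
  feq (tsub (upd (@Var S) a r) s) (tsub (upd (@Var S) a r) t).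
Proof. by rewrite /feq fsubE. Qed.

Lemma fsub_all c x a r : c != a -> c \notin tatoms r ->
  fsub (fall c x) a r = fall c (fsub x a r).
Proof.
elim/form_ind: x => phi ca cr; rewrite !(fsubE, fallE); apply/clsP => /=.
set L := flatten _; have := fresh_atomP L; move: (fresh_atom L) => b bL.
(* Adding the trivial update of [c] by itself gives the body the shape in which the binder [b]
   chosen by [rsub] can be exchanged for [c]. *)
rewrite (_ : rsub (upd (@Var S) a r) phi =
             rsub (upd (upd (@Var S) a r) c (Var S c)) phi); last first.
  congr rsub; apply: funext => d; rewrite {2}/upd; case: eqVneq => // ->.
  by rewrite /upd (negPf ca).
apply: alpha_All_rsub_of => [h t hI|d dP dc|d dP dc]; first exact: alpha_rren_rsub.
- by apply: contra bL => bd; apply/flatten_mapP; exists d; rewrite ?mem_filter ?dc.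
- by rewrite /upd; case: ifP => // _; rewrite inE eq_sym.
Qed.

Lemma fsub_fresh x a r : ffresh a x -> fsub x a r = x.
Proof.
elim/form_ind: x => phi /ffreshE aP; rewrite fsubE.
rewrite (@rsub_ext _ _ (@Var S \o id)); last first.
  by move=> c cP; rewrite /upd; case: eqVneq => // ca; rewrite -ca cP in aP.
rewrite (proj2 (clsP _ _) (alpha_rsub_Var phi (@inj_id _))) -Defs.factE //.
exact: fact_id.
Qed.

(** The link between instances of a universal predicate and the swappings in the filter condition on
    the new-quantifier. *)
Lemma fsub_Var x a b : ffresh b x -> fsub x a (Var S b) = fact (swap b a) x.
Proof.
elim/form_ind: x => phi /ffreshE bP; rewrite fsubE Defs.factE; last exact: swap_inj.
rewrite (@rsub_ext _ _ (@Var S \o swap b a)).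
  exact/clsP/alpha_rsub_Var/swap_inj.
move=> c cP; rewrite /upd /=; case: eqVneq => [->|ca]; first by rewrite swapR.
by rewrite swapN //; apply: contraNneq bP => <-.
Qed.

(** This makes the choice of the fresh atom [c] in [setsub] immaterial. *)
Lemma fsub_swap x a c r : ffresh c x ->
  fsub (fact (swap c a) x) c r = fsub x a r.
Proof.
elim/form_ind: x => phi /ffreshE cP.
rewrite Defs.factE; last exact: swap_inj.
rewrite !fsubE rsub_ren; last exact: swap_inj.
congr cls; apply: rsub_ext => d dP /=.
case: (eqVneq d a) => [->|da]; first by rewrite swapR /upd !eqxx.
have dc : d != c by apply: contraNneq cP => <-.
by rewrite swapN // /upd (negPf da) (negPf dc).
Qed.

Lemma fall_swap x a b : ffresh b x -> fall b (fact (swap b a) x) = fall a x.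
Proof.
elim/form_ind: x => phi /ffreshE bP.
rewrite Defs.factE; last exact: swap_inj.
rewrite !fallE; apply/clsP/alpha_All_swap.
by rewrite mem_filter (negPf bP) andbF.
Qed.

End Substitution.

(** * Derivability under permutation and substitution *)

Section Derivations.
Variable S : signature.
Implicit Types (x y : form S) (r s : term S) (Phi Psi : seq (form S)).

Lemma lk_mem x Phi Psi : x \in Phi -> x \in Psi -> lk Phi Psi.
Proof.
by move=> xP xQ; apply: lk_struct (lk_hyp x) => y /predU1P[->|].
Qed.

Lemma lk_cutR x Phi Psi : lk [::] [:: x] -> lk (x :: Phi) Psi -> lk Phi Psi.
Proof.
move=> H; apply: lk_cut; apply: lk_struct H => // y /predU1P[->|//].
exact: mem_head.
Qed.

(** A renaming carries each rule to an instance of the same rule; injectivity preserves the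
    freshness conditions of [lk_allR]. *)
Lemma lk_act h Phi Psi : injective h -> lk Phi Psi ->
  lk (map (fact h) Phi) (map (fact h) Psi).
Proof.
move=> hI.
have sub (A B : seq (form S)) : {subset A <= B} ->
    {subset map (fact h) A <= map (fact h) B}.
  by move=> AB _ /mapP[x /AB xB ->]; apply: map_f.
have fr a (A : seq (form S)) : {in A, forall y, ffresh a y} ->
    {in map (fact h) A, forall y, ffresh (h a) y}.
  by move=> aA _ /mapP[x /aA xB ->]; apply/ffresh_act.
elim=> {Phi Psi} /=.
- by move=> Phi Psi Phi' Psi' /sub PP /sub QQ _; apply: lk_struct.
- by move=> x; apply: lk_hyp.
- by move=> x Phi Psi _ H _ H'; apply: lk_cut H H'.
- by rewrite fact_bot //; apply: lk_botL.
- by move=> x y Phi Psi _ H; rewrite fact_and //; apply: lk_andL.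
- by move=> x y Phi Psi _ H _ H'; rewrite fact_and //; apply: lk_andR.
- by move=> x Phi Psi _ H; rewrite fact_neg //; apply: lk_negL.
- by move=> x Phi Psi _ H; rewrite fact_neg //; apply: lk_negR.
- by move=> a r x Phi Psi _; rewrite fact_sub // fact_all //; apply: lk_allL.
- move=> a x Phi Psi /fr aP /fr aQ _; rewrite fact_all //; exact: lk_allR.
- by move=> a r s x Phi Psi _; rewrite fact_eq // !fact_sub //; apply: lk_eqL.
- by move=> r; rewrite fact_eq //; apply: lk_eqR.
Qed.

Lemma entails_act h x y : injective h -> entails x y ->
  entails (fact h x) (fact h y).
Proof. by move=> hI; apply: lk_act. Qed.

(* Substitutivity comes from generalising x -> y over a, then instantiating. *)
Lemma entails_sub x y a r : entails x y -> entails (fsub x a r) (fsub y a r).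
Proof.
move=> xy.
have : lk [::] [:: fall a (fneg (fand x (fneg y)))].
  apply: lk_allR => //; apply: lk_negR; apply: lk_andL.
  apply: (@lk_struct _ [:: fneg y; x] [::]) => //.
    by move=> z; rewrite !inE orbC.
  exact: lk_negL.
move/lk_cutR; apply; apply: (@lk_allL _ a r).
rewrite fsub_neg fsub_and fsub_neg; apply: lk_negL; apply: lk_andR.
  exact: (lk_mem (mem_head _ _) (mem_head _ _)).
apply: lk_negR; exact: (lk_mem (mem_head _ _) (mem_head _ _)).
Qed.

End Derivations.

(** * Prime filters and their closure properties *)

Section Points.
Variable S : signature.
Implicit Types (x y : form S) (r s : term S) (p : set (form S)).

Lemma filter_mono p x y z : is_filter p -> p x -> p y -> lk [:: x; y] [:: z] -> p z.
Proof.
by move=> pF px py xyz; apply: (filter_up pF (filter_and pF px py)); apply: lk_andL.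
Qed.

Lemma filter_top p x : is_filter p -> lk [::] [:: x] -> p x.
Proof.
move=> pF xT; have [y py] := filter_nonempty pF.
by apply: (filter_up pF py); apply: lk_struct xT.
Qed.

Lemma filter_andE p x y : is_filter p -> p (fand x y) <-> p x /\ p y.
Proof.
move=> pF; split=> [pxy|[]]; last exact: filter_and.
split; apply: (filter_up pF pxy); apply: lk_andL.
  exact: (lk_mem (mem_head _ _) (mem_head _ _)).
by apply: (@lk_mem _ y); [rewrite in_cons mem_head orbT|exact: mem_head].
Qed.

(** Consistency gives one direction; primeness applied to the derivable excluded middle gives the
    other. *)
Lemma point_negE p x : Points p -> p (fneg x) <-> ~ p x.
Proof.
move=> [pF pP]; split=> [pn px|npx].
  apply: (filter_bot pF); apply: (filter_mono pF pn px).
  apply: lk_negL; exact: (lk_mem (mem_head _ _) (mem_head _ _)).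
have [//|//] : p x \/ p (fneg x).
apply: pP; apply: filter_top => //; apply: lk_negR; apply: lk_andL.
apply: (@lk_struct _ [:: fneg (fneg x); fneg x] [::]) => //.
  by move=> z; rewrite !inE orbC.
by apply: lk_negL; apply: lk_hyp.
Qed.

(** Replacing the direct image by a preimage along the inverse lets the filter conditions be read
    off [p] itself. *)
Lemma ptactE h k p x : injective h -> injective k -> cancel h k -> cancel k h ->
  ptact h p x <-> p (fact k x).
Proof.
move=> hI kI hK kK; split=> [[y py <-]|px]; first by rewrite fact_can.
by exists (fact k x) => //; rewrite fact_can.
Qed.

Lemma Points_act h p : bijective h -> Points p -> Points (ptact h p).
Proof.
case=> k hK kK [pF pP]; have hI := can_inj hK; have kI := can_inj kK.
have E := ptactE p _ hI kI hK kK; split; first split.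
- have [x px] := filter_nonempty pF; exists (fact h x); exact: imageP.
- by move/E; rewrite fact_bot // => /(filter_bot pF).
- by move=> x y /E px xy; apply/E/(filter_up pF px)/entails_act.
- by move=> x y /E px /E py; apply/E; rewrite fact_and //; apply: filter_and.
- move=> a x /newP[L LP]; apply/E; rewrite fact_all //; apply: Defs.filter_all => //.
  (* The exceptional atoms are pulled back along [h]; then [k] after [swap (h c) a] equals
     [swap c (k a)] after [k]. *)
  apply/newP; exists (map k L) => c cL.
  have /LP/E : h c \notin L by apply: contra cL => hc; rewrite -(hK c) map_f.
  rewrite !fact_comp //; try exact: swap_inj.
  congr p; apply: fact_ext => [||d _ /=].
  + exact: inj_comp kI (@swap_inj _ _).
  + exact: inj_comp (@swap_inj _ _) kI.
  by rewrite inj_swap // hK.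
- move=> x y /E; rewrite /for_ fact_neg // fact_and // !fact_neg // => /pP.
  by case=> H; [left|right]; apply/E.
Qed.

Lemma Points_sub p r a : Points p -> Points (ptsub p r a).
Proof.
case=> pF pP; split; first split.
- exists (fneg (fbot S)); rewrite /ptsub /= fsub_neg fsub_bot.
  by apply: filter_top => //; apply: lk_negR; apply: lk_botL.
- by rewrite /ptsub /= fsub_bot; apply: filter_bot.
- by move=> x y px xy; apply: (filter_up pF px); apply: entails_sub.
- by move=> x y px py; rewrite /ptsub /= fsub_and; apply: filter_and.
- move=> b x; rewrite /ptsub /= => pN.
  have := fresh_atomP (a :: tatoms r ++ rfv (repr x)).
  move: (fresh_atom _) => d; rewrite inE mem_cat !negb_or => /and3P[da dr dx].
  (* The bound atom [b] may be [a] or occur in [r]; it is renamed to the fresh [d] so that the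
     substitution passes under the quantifier. *)
  rewrite -(@fall_swap _ x b d) // fsub_all //; apply: Defs.filter_all => //.
  apply: (@sub_new (a :: tatoms r ++ rfv (repr x))) pN => c.
  rewrite inE mem_cat !negb_or => /and3P[ca cr cx].
  (* The swapping of [c] and [d] fixes [a] and [r], and on the free atoms of [x] the two successive
     swappings act as the single [swap c b]. *)
  congr p; rewrite fact_sub; last exact: swap_inj.
  rewrite swapN 1?eq_sym // tren_id; last first.
    by move=> z zr; rewrite swapN //; [apply: contraNneq cr|apply: contraNneq dr] => <-.
  rewrite fact_comp; [|exact: swap_inj..].
  congr fsub; apply: fact_ext => [||z zx /=]; first exact: swap_inj.
    exact: inj_comp (@swap_inj _ _) (@swap_inj _ _).
  case: (eqVneq z b) => [->|zb]; first by rewrite !swapR.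
  have zc : z != c by apply/negP => /eqP zc; apply: zx; rewrite zc.
  have zd : z != d by apply/negP => /eqP zd; apply: zx; rewrite zd.
  by rewrite !swapN.
- by move=> x y; rewrite /ptsub /for_ /= fsub_neg fsub_and !fsub_neg => /pP.
Qed.

Lemma point_eqE p r s : Points p ->
  p (feq r s) <-> new (fun c => ptsub p r c = ptsub p s c).
Proof.
move=> [pF _].
have step c x t u : p (feq t u) -> p (fsub x c t) -> p (fsub x c u).
  move=> tu px; apply: (filter_mono pF tu px); apply: lk_eqL; exact: lk_hyp.
have refl t : p (feq t t) by apply: filter_top => //; apply: lk_eqR.
have updE a t : upd (@Var S) a t a = t by rewrite /upd eqxx.
split=> [prs|/newP[L LP]].
  (* Symmetry, needed for the reverse inclusion: replacing [r] by [s] in the predicate [c = r], at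
     the place of [c], turns reflexivity into [s = r]. *)
  have psr : p (feq s r).
    have := fresh_atomP (tatoms r); move: (fresh_atom _) => c cr.
    have := step c (feq (Var S c) r) _ _ prs.
    by rewrite !fsub_eq /= !updE !tsub_upd_fresh //; apply.
  by apply/newP; exists [::] => c _; apply/seteqP; split=> x; apply: step.
have := fresh_atomP (L ++ tatoms r); move: (fresh_atom _) => c.
rewrite mem_cat negb_or => /andP[/LP cE cr].
have : ptsub p r c (feq r (Var S c)).
  by rewrite /ptsub /= fsub_eq /= updE tsub_upd_fresh.
by rewrite cE /ptsub /= fsub_eq /= updE tsub_upd_fresh.
Qed.

(** * Sets of points determined by a predicate, and the interpretation *)

Definition points_of x : set (set (form S)) := [set p | Points p /\ p x].

Lemma setact_points_of h x : bijective h ->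
  setact h (points_of x) = points_of (fact h x).
Proof.
move=> hB; have [k hK kK] := hB; have hI := can_inj hK; have kI := can_inj kK.
apply/seteqP; split=> [_ [p [pp px] <-]|p [pp px]].
  by split; [exact: Points_act|exact: imageP].
exists (ptact k p).
  split; first by apply: Points_act => //; exists h.
  by apply/(@ptactE k h).
apply/seteqP; split=> y.
  by move=> /(@ptactE h k)-/(_ hI kI hK kK) /(@ptactE k h); rewrite fact_can //; apply.
by move=> py; apply/(@ptactE h k) => //; exact: imageP.
Qed.

Lemma swap_bij a b : bijective (swap a b).
Proof. exact/inv_bij/swapK. Qed.

Lemma setsub_points_of x a r : setsub (points_of x) a r = points_of (fsub x a r).
Proof.
apply/seteqP; split=> p [pp].
  (* The goal does not mention [c], so it can be placed under [new] and compared with [pN] at fresh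
     atoms only. *)
  move=> pN; split=> //; apply/new_cst.
  apply: (@sub_new (rfv (repr x))) pN => c cx.
  rewrite setact_points_of; last exact: swap_bij.
  by case=> _; rewrite /ptsub /= fsub_swap.
move=> px; split=> //; apply/newP; exists (rfv (repr x)) => c cx.
rewrite setact_points_of; last exact: swap_bij.
by split; [exact: Points_sub|rewrite /ptsub /= fsub_swap].
Qed.

(** The free atoms of [x] serve as support and as exceptional set in both conditions: substituting
    for a fresh atom changes nothing, and substituting a fresh atom is a swapping. *)
Lemma pow_sigma_points_of x : pow_sigma (points_of x).
Proof.
split.
- by move=> p [].
- exists [set` rfv (repr x)]; first exact: finite_seq.
  move=> h [hB _] hE; rewrite setact_points_of // fact_id //.
    exact: bij_inj.
  by move=> c /negP; rewrite negbK => /hE.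
- move=> r; apply/newP; exists (rfv (repr x)) => a ax p pp.
  rewrite /points_of /ptsub /= fsub_fresh //.
  by split=> -[_ px]; split=> //; apply: Points_sub.
- move=> a; apply/newP; exists (rfv (repr x)) => b bx p pp.
  rewrite /points_of /ptsub /= fsub_Var //.
  have E := @ptactE (swap b a) (swap b a) p x (@swap_inj _ _) (@swap_inj _ _)
              (swapK _ _) (swapK _ _).
  split=> -[_ H]; split.
  + exact: Points_act (swap_bij _ _) pp.
  + exact/E.
  + exact: Points_sub.
  + exact/E.
Qed.

Lemma points_of_all x a :
  \bigcap_(r in [set: term S]) points_of (fsub x a r) = points_of (fall a x).
Proof.
apply/seteqP; split=> p.
  (* Some instance is needed to know that [p] is a point; a variable is a term in every
     signature. *)
  move=> H; have [[pF pP] _] := H (Var S a) I; split=> //.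
  apply: Defs.filter_all => //; apply/newP; exists (rfv (repr x)) => b bx.
  by rewrite -fsub_Var //; have [] := H (Var S b) I.
move=> [pp px] r _; split=> //; case: pp => pF _; apply: (filter_up pF px).
by apply: (@lk_allL _ a r); apply: lk_hyp.
Qed.

Lemma predI_points_of (nu : atom_choice S) (P : predsym S)
    (rs : 'I_(parity P) -> term S) : admissible nu ->
  Defs.predI nu rs = points_of (fpr rs).
Proof.
move=> nuP; have [aI aP] := nuP P rs; rewrite /Defs.predI.
set a := nu P rs in aI aP *.
(* The argument vector once the positions in [A] have been substituted. Freshness of the [a i]
   protects the positions already done, distinctness those still to come; the fold runs from the
   empty [A] to the full one. *)
pose mix (A : pred 'I_(parity P)) i := if A i then rs i else Var S (a i).
have H l (A : pred 'I_(parity P)) : 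
    foldl (fun X i => setsub X (a i) (rs i)) (points_of (fpr (mix A))) l =
    points_of (fpr (mix (fun i => A i || (i \in l)))).
  elim: l A => [|j l IH] A /=.
    by congr (points_of (fpr (mix _))); apply: funext => i; rewrite orbF.
  rewrite setsub_points_of /fpr fsubE /=.
  rewrite (_ : (fun i => tsub _ _) = mix (fun i => A i || (i == j))); last first.
    apply: funext => i; rewrite /mix; case: (A i) => /=.
      exact: tsub_upd_fresh.
    by rewrite /upd inj_eq //; case: eqVneq => [->|].
  rewrite IH; congr (points_of (fpr (mix _))).
  by apply: funext => i; rewrite inE orbA.
rewrite (H _ xpred0); congr (points_of (fpr _)).
by apply: funext => i; rewrite /mix mem_enum.
Qed.

Lemma interp_points_of (nu : atom_choice S) (phi : raw S) : admissible nu ->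
  interp nu phi = points_of (cls phi).
Proof.
move=> nuP; elim: phi => [|r s|P rs|phi IH psi IH'|phi IH|a phi IH] /=.
- by apply/seteqP; split=> // p [[pF _]] /(filter_bot pF).
- by apply/seteqP; split=> p [pp] /(point_eqE _ _ pp).
- exact: predI_points_of.
- rewrite IH IH' -fandE; apply/seteqP; split=> p.
    by move=> [[pp px] [_ py]]; split=> //; apply/filter_andE; first case: pp.
  by move=> [pp]; case: (pp) => pF _ /(filter_andE _ _ pF) [].
- rewrite IH -fnegE; apply/seteqP; split=> p [pp].
    by move=> npx; split=> //; apply/point_negE => // px; apply: npx.
  by move=> /(point_negE _ pp) npx; split=> // -[].
- rewrite IH -fallE -points_of_all; apply: eq_bigcapr => r _.
  exact: setsub_points_of.
Qed.

End Points.

Theorem theorem7p30 (S : signature) (nu : atom_choice S) (nuP : admissible nu)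
    (phi : raw S) :
  pow_sigma (interp nu phi) /\
  interp nu phi = [set p : set (form S) | Points p /\ p (cls phi)].
Proof.
by rewrite interp_points_of //; split=> //; apply: pow_sigma_points_of.
Qed.
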